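(* Let $H(k)=2H_{4k}-3H_{2k}+H_k$ for $k\in\{0,1,2,\ldots\}$. Then the following ten identities hold: $$\sum_{k=0}^\infty\frac{\binom{4k}{k}\left((224k^2-86k+1)H(k)+182k+5\right)}{(-256)^k}=\frac{9-5\log 2}{4\sqrt{2}},$$ $$\sum_{k=0}^\infty \frac{\binom{4k}{k}\left((112k^2+110k+23)H(k)+28k+16\right)}{(3k+1)(3k+2)(-256)^k}=8\sqrt{2}\log 2,$$ $$\sum_{k=0}^\infty\frac{\binom{4k}{k}\left((200k^2+76k-17)H(k)-8(725k-49)\right)}{128^k}=\sqrt{2}\,(144+5\log 2),$$ $$\sum_{k=0}^\infty \frac{\binom{4k}{k}\left((40k^2+44k+11)H(k)-8(k+1)\right)}{(3k+1)(3k+2)128^k}=-4\sqrt{2}\log 2,$$ $$\sum_{k=0}^\infty\frac{\binom{4k}{k}\left((3575k^2-1026k+67)H(k)+\frac{242}{13}(175k+12)\right)}{(-72)^k}=\sqrt{3}\left(\frac{216}{13}-15\log 3\right),$$ $$\sum_{k=0}^\infty \frac{\binom{4k}{k}\left((55k^2+54k+11)H(k)+22k+12\right)}{(3k+1)(3k+2)(-72)^k}=3\sqrt{3}\log 3,$$ $$\sum_{k=0}^\infty\frac{\binom{4k}{k}\left((21413k^2-1409k+1036)H(k)+\frac{4}{23}(118237k+17320)\right)}{(-25)^k}=\sqrt{5}\left(\frac{1440}{23}-100\log 5\right),$$ $$\sum_{k=0}^\infty \frac{\binom{4k}{k}\left((133k^2+131k+26)H(k)+76k+40\right)}{(3k+1)(3k+2)(-25)^k}=5\sqrt{5}\log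 5,$$ $$\sum_{k=0}^\infty\frac{\binom{4k}{k}\left((49k^2-146k+21)H(k)-3038k+1160\right)}{24^k}=\sqrt{3}\,(216-5\log 3),$$ $$\sum_{k=0}^\infty \frac{\binom{4k}{k}\left((7k^2+10k+3)H(k)-2k-4\right)}{(3k+1)(3k+2)24^k}=-\sqrt{3}\log 3.$$
   Context: For $n\in\{0,1,2,\ldots\}$, $H_n=\sum_{0<k\le n}\frac1k$ denotes the $n$-th harmonic number (so $H_0=0$). $\log$ is the natural logarithm. *)

(* Defs.v *)
From Stdlib Require Import Reals.
From Coquelicot Require Import Coquelicot.
Open Scope R_scope.

(* An interval sum from 1 to 0 is empty, so [harmonic 0 = 0]. *)
Definition harmonic (n : nat) : R := sum_n_m (fun k : nat => / INR k) 1 n.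

Definition Hcomb (k : nat) : R :=
  2 * harmonic (4 * k) - 3 * harmonic (2 * k) + harmonic k.

(* [C] alone would be Coquelicot's type of complex numbers. *)
Definition binom4 (k : nat) : R := Binomial.C (4 * k) k.

(* Main.v *)
Require Import Defs.
From Stdlib Require Import Factorial Reals Lra Lia.
From Coquelicot Require Import Coquelicot.
Open Scope R_scope.

(** The proof integrates an algebraic generating function.

    The combination [Hcomb k] is [ln 2] minus the integral of [s^(4k) * kernel s] over [0, 1], with
    [kernel s = 2 (1 - s) / ((1 + s) (1 + s^2))] ([moment_at_1]). Hence a series of terms
    [a k * Hcomb k] equals [ln 2] times the sum of [a] minus the integral of the generating function
    of [a], at the argument [s^4], against the kernel ([series_of_moments]).

    For the binomials [C (4k + r) k] the generating function is known in terms of the root [t] of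
    [z = t (1 - t)^3]: it is [1 / ((1 - t)^r (1 - 4 t))] ([shifted_sum_closed]). The shifts
    [r = 0, 1, 2] yield all weights that are quadratic polynomials in [k] over
    [(3k + 1) (3k + 2)]. Along the path [s = v / nu] with [nu = c + (1 - c) v^4] the root is a rational
    function of [v], so everything reduces to integrating a rational function
    ([weighted_moment_series]).

    The poles of that function lie over [s^4 = 1], where the generating function takes its values
    at the four roots of one quartic. The ten identities concern arguments
    [x = (d - 1)^3 / (64 d)], with [d = 1/2, 2, 1/3, 1/5, 3], for which this quartic
    splits into quadratic factors over the field of [q = sqrt d]. The weight [quad d] is
    chosen so that the generating function equals [4 q] on the roots of one factor
    and [- 4 q] on those of the other. The primitive is then [4 q] times logarithms of polynomials
    plus a polynomial ([primitive_derive]). At the endpoint the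
    logarithms collapse to [ln 2 + ln d], and the polynomial part is cancelled by the linear weight
    [lin d]. This gives [- 4 q ln d], uniformly in [d] ([harmonic_quad_series]). All is
    expressed rationally in [g = sqrt (2 / q - 1)].

    The five identities with denominators [(3k + 1) (3k + 2)] are multiples of this result. The other
    five follow by adding a multiple of the harmonic-free series, whose sum is [4 q], and a telescoping
    series ([harmonic_telescoped_series]). *)

(** * Binomial coefficients with shifted upper index *)

(** The family [C (4k + r) k] for all shifts [r] is closed under Pascal's rule,
    which the central family [r = 0] alone is not. *)
Definition shifted_binom (r k : nat) : R := Binomial.C (4 * k + r) k.

Lemma shifted_binom_0 k : shifted_binom 0 k = binom4 k.
Proof. unfold shifted_binom, binom4. now rewrite Nat.add_0_r. Qed.

Lemma shifted_binom_at_0 r : shifted_binom r 0 = 1.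
Proof.
  unfold shifted_binom, Binomial.C. simpl (4 * 0 + r)%nat. rewrite Nat.sub_0_r.
  simpl (fact 0). simpl (INR 1). field. apply INR_fact_neq_0.
Qed.

Lemma shifted_binom_pos r k : 0 < shifted_binom r k.
Proof.
  unfold shifted_binom, Binomial.C.
  apply Rdiv_lt_0_compat; [|apply Rmult_lt_0_compat]; apply INR_fact_lt_0.
Qed.

Lemma shifted_binom_pascal r k :
  shifted_binom (S r) (S k) = shifted_binom r (S k) + shifted_binom (r + 4) k.
Proof.
  unfold shifted_binom.
  replace (4 * S k + S r)%nat with (S (4 * S k + r)) by lia.
  rewrite <- pascal by lia.
  replace (4 * k + (r + 4))%nat with (4 * S k + r)%nat by lia. ring.
Qed.

Lemma shifted_binom_S r k :
  shifted_binom (S r) k * (3 * INR k + INR r + 1)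
  = shifted_binom r k * (4 * INR k + INR r + 1).
Proof.
  unfold shifted_binom, Binomial.C.
  replace (4 * k + S r)%nat with (S (4 * k + r)) by lia.
  replace (S (4 * k + r) - k)%nat with (S (3 * k + r)) by lia.
  replace (4 * k + r - k)%nat with (3 * k + r)%nat by lia.
  rewrite !fact_simpl, !mult_INR, !S_INR, !plus_INR, !mult_INR.
  assert (0 <= INR k) by apply pos_INR. assert (0 <= INR r) by apply pos_INR.
  simpl (INR 4). simpl (INR 3).
  field. repeat split; try apply INR_fact_neq_0. lra.
Qed.

Lemma shifted_binom_3 k : shifted_binom 3 k = binom4 (S k) / 4.
Proof.
  unfold shifted_binom, binom4, Binomial.C.
  replace (4 * S k)%nat with (S (4 * k + 3)) by lia.
  replace (S (4 * k + 3) - S k)%nat with (3 * k + 3)%nat by lia.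
  replace (4 * k + 3 - k)%nat with (3 * k + 3)%nat by lia.
  rewrite !(fact_simpl (4 * k + 3)), !(fact_simpl k), !mult_INR, !S_INR, !plus_INR, !mult_INR.
  assert (0 <= INR k) by apply pos_INR.
  simpl (INR 4). simpl (INR 3).
  field. repeat split; try apply INR_fact_neq_0. lra.
Qed.

Lemma binom4_S k :
  binom4 (S k) * (3 * (INR k + 1) * (3 * INR k + 1) * (3 * INR k + 2))
  = binom4 k * (8 * (4 * INR k + 3) * (2 * INR k + 1) * (4 * INR k + 1)).
Proof.
  assert (Hk := pos_INR k).
  assert (E3 := shifted_binom_3 k).
  assert (E2 := shifted_binom_S 2 k).
  assert (E1 := shifted_binom_S 1 k).
  assert (E0 := shifted_binom_S 0 k).
  rewrite shifted_binom_0 in E0. simpl (INR 2) in E2. simpl (INR 1) in E1. simpl (INR 0) in E0.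
  replace (binom4 (S k)) with (4 * shifted_binom 3 k) by lra.
  replace (shifted_binom 3 k) with (shifted_binom 2 k * (4 * INR k + 3) / (3 * INR k + 3))
    by (field_simplify_eq; lra).
  replace (shifted_binom 2 k) with (shifted_binom 1 k * (4 * INR k + 2) / (3 * INR k + 2))
    by (field_simplify_eq; lra).
  replace (shifted_binom 1 k) with (binom4 k * (4 * INR k + 1) / (3 * INR k + 1))
    by (field_simplify_eq; lra).
  field. lra.
Qed.

(** The true growth rate is [256/27]; the rounder [10] still leaves room for all
    the arguments used below. *)
Lemma binom4_le k : binom4 k <= 10 ^ k.
Proof.
  induction k as [|k IH].
  - rewrite <- shifted_binom_0, shifted_binom_at_0. simpl. lra.
  - assert (Hk := pos_INR k). assert (E := binom4_S k). simpl pow.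
    assert (P := shifted_binom_pos 0 k). rewrite shifted_binom_0 in P.
    apply Rmult_le_reg_r with (3 * (INR k + 1) * (3 * INR k + 1) * (3 * INR k + 2)).
    + repeat apply Rmult_lt_0_compat; lra.
    + rewrite E.
      apply Rle_trans with (binom4 k * (10 * (3 * (INR k + 1) * (3 * INR k + 1) * (3 * INR k + 2)))).
      * apply Rmult_le_compat_l; [lra|]. nra.
      * rewrite <- Rmult_assoc. apply Rmult_le_compat_r; [|lra].
        repeat apply Rmult_le_pos; lra.
Qed.

Lemma shifted_binom_le r k : shifted_binom r k <= (4 / 3) ^ r * 10 ^ k.
Proof.
  induction r as [|r IH].
  - rewrite shifted_binom_0. simpl. rewrite Rmult_1_l. apply binom4_le.
  - assert (Hk := pos_INR k). assert (Hr := pos_INR r).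
    assert (E := shifted_binom_S r k).
    assert (P := shifted_binom_pos r k).
    assert (B : shifted_binom (S r) k <= 4 / 3 * shifted_binom r k).
    { apply Rmult_le_reg_r with (3 * INR k + INR r + 1); [lra|]. rewrite E.
      assert (0 <= shifted_binom r k * (INR r + 1)) by (apply Rmult_le_pos; lra). lra. }
    simpl pow. nra.
Qed.

(** * Generating functions *)

(** Iterating the recurrence [j] times improves the growth bound by the factor
    [(|theta| (g + g^2 + g^3))^j], which tends to [0]. *)
Lemma bounded_recurrence_zero (V : nat -> R) (theta g M : R) :
  0 <= g -> Rabs theta * (g + g ^ 2 + g ^ 3) < 1 ->
  (forall r, Rabs (V r) <= M * g ^ r) ->
  (forall r, V r = theta * (V (S r) + V (S (S r)) + V (S (S (S r))))) ->
  forall r, V r = 0.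
Proof.
  intros Hg Hlt HM HV r.
  set (lam := Rabs theta * (g + g ^ 2 + g ^ 3)) in *.
  assert (Hth := Rabs_pos theta).
  assert (Hlam : 0 <= lam).
  { unfold lam. apply Rmult_le_pos; [lra|].
    assert (0 <= g ^ 2) by (apply pow_le; lra).
    assert (0 <= g ^ 3) by (apply pow_le; lra). lra. }
  assert (B : forall j r, Rabs (V r) <= M * g ^ r * lam ^ j).
  { induction j as [|j IH]; intros i.
    - rewrite pow_O, Rmult_1_r. apply HM.
    - rewrite HV, Rabs_mult.
      apply Rle_trans with
        (Rabs theta * (M * g ^ S i * lam ^ j + M * g ^ S (S i) * lam ^ j
                       + M * g ^ S (S (S i)) * lam ^ j)).
      + apply Rmult_le_compat_l; [lra|].
        eapply Rle_trans; [apply Rabs_triang|].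
        apply Rplus_le_compat; [|apply IH].
        eapply Rle_trans; [apply Rabs_triang|].
        apply Rplus_le_compat; apply IH.
      + right. simpl. unfold lam. ring. }
  assert (L : is_lim_seq (fun j => M * g ^ r * lam ^ j) 0).
  { replace (Finite 0) with (Rbar_mult (M * g ^ r) 0)
      by (simpl; now rewrite Rmult_0_r).
    apply is_lim_seq_scal_l. apply is_lim_seq_geom.
    rewrite Rabs_pos_eq; lra. }
  assert (H := is_lim_seq_le (fun _ => Rabs (V r)) _ _ _ (fun j => B j r)
                 (is_lim_seq_const _) L).
  simpl in H. assert (P := Rabs_pos (V r)).
  destruct (Req_dec (V r) 0) as [|N]; [assumption|].
  assert (0 < Rabs (V r)) by now apply Rabs_pos_lt. lra.
Qed.

Lemma ex_series_Rscal (c : R) (a : nat -> R) :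
  ex_series a -> ex_series (fun k => c * a k).
Proof. exact (ex_series_scal_l (K := R_AbsRing) (V := R_NormedModule) c a). Qed.

Lemma ex_series_shifted_abs r z :
  Rabs z < / 10 -> ex_series (fun k => Rabs (shifted_binom r k * z ^ k)).
Proof.
  intros Hz. assert (P := Rabs_pos z).
  apply @ex_series_le with (fun k => (4 / 3) ^ r * (10 * Rabs z) ^ k).
  - intros k. unfold norm; simpl; unfold abs; simpl. rewrite Rabs_Rabsolu, Rabs_mult, <- RPow_abs, Rpow_mult_distr.
    rewrite (Rabs_pos_eq (shifted_binom r k)) by apply Rlt_le, shifted_binom_pos.
    rewrite <- Rmult_assoc. apply Rmult_le_compat_r; [now apply pow_le|].
    apply shifted_binom_le.
  - apply ex_series_Rscal. apply ex_series_geom. rewrite Rabs_pos_eq; lra.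
Qed.

Definition shifted_sum (r : nat) (z : R) : R :=
  Series (fun k => shifted_binom r k * z ^ k).

Lemma ex_series_shifted r z :
  Rabs z < / 10 -> ex_series (fun k => shifted_binom r k * z ^ k).
Proof. intros Hz. now apply ex_series_Rabs, ex_series_shifted_abs. Qed.

Lemma shifted_sum_bound r z :
  Rabs z < / 10 -> Rabs (shifted_sum r z) <= (4 / 3) ^ r * / (1 - 10 * Rabs z).
Proof.
  intros Hz. assert (P := Rabs_pos z).
  assert (Hq : Rabs (10 * Rabs z) < 1) by (rewrite Rabs_pos_eq; lra).
  rewrite <- (Series_geom _ Hq), <- Series_scal_l.
  unfold shifted_sum.
  eapply Rle_trans; [apply Series_Rabs; now apply ex_series_shifted_abs|].
  apply Series_le.
  - intros k. split; [apply Rabs_pos|].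
    rewrite Rabs_mult, <- RPow_abs, Rpow_mult_distr.
    rewrite (Rabs_pos_eq (shifted_binom r k)) by apply Rlt_le, shifted_binom_pos.
    rewrite <- Rmult_assoc. apply Rmult_le_compat_r; [now apply pow_le|].
    apply shifted_binom_le.
  - apply ex_series_Rscal. now apply ex_series_geom.
Qed.

Lemma shifted_sum_pascal r z : Rabs z < / 10 ->
  shifted_sum (S r) z = shifted_sum r z + z * shifted_sum (r + 4) z.
Proof.
  intros Hz. unfold shifted_sum.
  rewrite (Series_incr_1 (fun k => shifted_binom (S r) k * _)),
          (Series_incr_1 (fun k => shifted_binom r k * _)) by now apply ex_series_shifted.
  rewrite !shifted_binom_at_0, <- Series_scal_l.
  rewrite Rplus_assoc, <- Series_plus.
  - f_equal. apply Series_ext. intros k. rewrite shifted_binom_pascal. simpl. ring.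
  - now apply -> (ex_series_incr_1 (fun k => shifted_binom r k * z ^ k)); apply ex_series_shifted.
  - apply ex_series_Rscal. now apply ex_series_shifted.
Qed.

(** This closes the system of the [shifted_sum]s: [C (4k + 3) k] is a quarter of
    [C (4k + 4) (k + 1)], which leads from the shift [3] back to the shift [0]. *)
Lemma shifted_sum_3 z : Rabs z < / 10 ->
  4 * z * shifted_sum 3 z = shifted_sum 0 z - 1.
Proof.
  intros Hz. unfold shifted_sum.
  rewrite (Series_incr_1 (fun k => shifted_binom 0 k * _)) by now apply ex_series_shifted.
  rewrite !shifted_binom_at_0, <- Series_scal_l. simpl pow at 2.
  rewrite Rmult_1_r. ring_simplify.
  apply Series_ext. intros k. rewrite shifted_binom_3, shifted_binom_0. simpl. field.
Qed.

(** With [|t| < 1/16] the argument [t (1 - t)^3] stays in the disc where the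
    bound [10^k] on the coefficients gives convergence, for both signs of [t]. *)
Lemma small_root_bound t : Rabs t < / 16 -> Rabs (t * (1 - t) ^ 3) < / 10.
Proof.
  intros Ht. apply Rabs_def2 in Ht. rewrite Rabs_mult.
  rewrite (Rabs_pos_eq ((1 - t) ^ 3)) by (apply pow_le; lra).
  assert ((1 - t) ^ 3 <= (17/16) ^ 3) by (apply pow_incr; lra).
  assert (0 <= (1 - t) ^ 3) by (apply pow_le; lra).
  assert (Rabs t <= / 16) by (apply Rabs_le; lra).
  assert (0 <= Rabs t) by apply Rabs_pos.
  apply Rle_lt_trans with (/16 * (17/16)^3); [|lra].
  apply Rmult_le_compat; lra.
Qed.

(** Put [U r = (1 - t)^r * shifted_sum r z] with [z = t (1 - t)^3]. Pascal's rule
    becomes [U (r+1) = (1 - t) U r + t U (r+4)], so the differences of [U]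
    satisfy a three-term recurrence with the small coefficient [t / (1 - t)] and
    vanish. Hence [U] is constant, and [shifted_sum_3] determines the constant.
    This replaces Lagrange inversion for the quartic [B = 1 + z B^4], whose root
    is [B = 1 / (1 - t)]. *)
Lemma shifted_sum_closed t r : Rabs t < / 16 ->
  (1 - t) ^ r * shifted_sum r (t * (1 - t) ^ 3) = / (1 - 4 * t).
Proof.
  intros Ht. assert (Hz := small_root_bound t Ht).
  set (z := t * (1 - t) ^ 3) in *.
  set (U := fun r => (1 - t) ^ r * shifted_sum r z).
  change (U r = / (1 - 4 * t)).
  assert (Hb := Rabs_def2 _ _ Ht).
  set (M := / (1 - 10 * Rabs z)).
  assert (HM : 0 < M) by (apply Rinv_0_lt_compat; lra).
  assert (HU : forall i, Rabs (U i) <= M * (17 / 12) ^ i).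
  { intros i. unfold U. rewrite Rabs_mult, (Rabs_pos_eq ((1 - t) ^ i)) by (apply pow_le; lra).
    replace (17 / 12) with (17 / 16 * (4 / 3)) by field. rewrite Rpow_mult_distr.
    apply Rle_trans with ((17/16)^i * ((4/3)^i * M)); [|right; ring].
    apply Rmult_le_compat; [apply pow_le; lra|apply Rabs_pos|apply pow_incr; lra|].
    now apply shifted_sum_bound. }
  assert (HP : forall i, U (S i) = (1 - t) * U i + t * U (i + 4)%nat).
  { intros i. unfold U. rewrite (shifted_sum_pascal i z Hz). rewrite pow_add. unfold z. simpl. ring. }
  assert (HV : forall i, U (S i) - U i = 0).
  (* 17/12 = 17/16 * 4/3 combines |1 - t| < 17/16 with the growth of the binomials *)
  { apply (bounded_recurrence_zero _ (t / (1 - t)) (17 / 12) (M * (1 + 17 / 12))); [lra| | |].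
    - unfold Rdiv. rewrite Rabs_mult, (Rabs_pos_eq (/ (1 - t)))
        by (apply Rlt_le, Rinv_0_lt_compat; lra).
      assert (Rabs t <= / 16) by lra.
      assert (/ (1 - t) <= / (15 / 16)) by (apply Rinv_le_contravar; lra).
      assert (0 < / (1 - t)) by (apply Rinv_0_lt_compat; lra).
      assert (Rabs t * / (1 - t) <= / 16 * / (15 / 16))
        by (apply Rmult_le_compat; try lra; apply Rabs_pos).
      lra.
    - intros i. unfold Rminus. eapply Rle_trans; [apply Rabs_triang|]. rewrite Rabs_Ropp.
      assert (A := HU i). assert (B := HU (S i)). simpl in B.
      rewrite Rmult_plus_distr_l, Rmult_plus_distr_r. lra.
    - intros i. apply Rmult_eq_reg_l with (1 - t); [|lra].
      replace ((1 - t) * (t / (1 - t) * (U (S (S i)) - U (S i) + (U (S (S (S i))) - U (S (S i)))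
         + (U (S (S (S (S i)))) - U (S (S (S i)))))))
        with (t * (U (S (S (S (S i)))) - U (S i))) by (field; lra).
      assert (E := HP i). replace (i + 4)%nat with (S (S (S (S i)))) in E by lia. lra. }
  assert (HC : forall i, U i = U 0%nat).
  { induction i as [|i IH]; [reflexivity|]. assert (E := HV i). lra. }
  rewrite HC. apply Rmult_eq_reg_l with (1 - 4 * t); [|lra].
  rewrite Rinv_r by lra.
  assert (E := shifted_sum_3 z Hz).
  assert (E3 := HC 3%nat). unfold U in *.
  replace (4 * z * shifted_sum 3 z) with (4 * t * ((1 - t) ^ 3 * shifted_sum 3 z)) in E
    by (unfold z; ring).
  rewrite E3 in E. simpl pow in *. lra.
Qed.

(** * Harmonic numbers as moments *)

Lemma harmonic_S n : harmonic (S n) = harmonic n + / (INR n + 1).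
Proof. unfold harmonic. rewrite sum_n_Sm by lia. now rewrite S_INR. Qed.

Lemma harmonic_0 : harmonic 0 = 0.
Proof. unfold harmonic. now rewrite sum_n_m_zero by lia. Qed.

Definition Hcomb_step (k : nat) : R :=
  2 / (4 * INR k + 1) - 4 / (4 * INR k + 2) + 2 / (4 * INR k + 3).

Lemma Hcomb_0 : Hcomb 0 = 0.
Proof. unfold Hcomb. simpl Nat.mul. rewrite harmonic_0. ring. Qed.

Lemma Hcomb_S k : Hcomb (S k) = Hcomb k + Hcomb_step k.
Proof.
  unfold Hcomb, Hcomb_step.
  replace (4 * S k)%nat with (S (S (S (S (4 * k))))) by lia.
  replace (2 * S k)%nat with (S (S (2 * k))) by lia.
  rewrite !harmonic_S, !S_INR, !mult_INR. simpl (INR 4). simpl (INR 2).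
  assert (Hk := pos_INR k). field. lra.
Qed.

Lemma Hcomb_bound k : 0 <= Hcomb k <= 2 * INR k.
Proof.
  induction k as [|k IH].
  - rewrite Hcomb_0. simpl. lra.
  - rewrite Hcomb_S, S_INR. assert (Hk := pos_INR k).
    assert (0 <= Hcomb_step k <= 2); [|lra].
    unfold Hcomb_step.
    replace (2 / (4 * INR k + 1) - 4 / (4 * INR k + 2) + 2 / (4 * INR k + 3))
      with (4 / ((4 * INR k + 1) * (4 * INR k + 2) * (4 * INR k + 3))) by (field; lra).
    assert (2 <= (4 * INR k + 1) * (4 * INR k + 2) * (4 * INR k + 3)) by nra.
    split.
    + apply Rlt_le, Rdiv_lt_0_compat; lra.
    + apply Rle_div_l; lra.
Qed.

(** Writing [H_n] as the integral of [(1 - s^n) / (1 - s)] over [0, 1] and bringing the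
    three harmonic numbers to the same power [s^(4k)] turns [Hcomb k] into the
    integral of [(1 - s^(4k)) * kernel s]; the poles at [s = 1] cancel because
    [2 - 3 + 1 = 0]. *)
Definition kernel (s : R) : R := 2 * (1 - s) / ((1 + s) * (1 + s ^ 2)).

(** The integral of [kernel u * u^(4k)] for [u] from [0] to [s], in closed form. The
    recursion comes from [(1 - u^4) * kernel u = 2 (1 - u)^2]. *)
Fixpoint moment (k : nat) (s : R) : R :=
  match k with
  | O => 2 * ln (1 + s) - ln (1 + s ^ 2)
  | S j => moment j s
      - 2 * (s ^ (4 * j + 1) / (4 * INR j + 1) - 2 * (s ^ (4 * j + 2) / (4 * INR j + 2))
             + s ^ (4 * j + 3) / (4 * INR j + 3))
  end.

Lemma moment_derive k s : 0 <= s -> is_derive (moment k) s (kernel s * s ^ (4 * k)).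
Proof.
  intros Hs. induction k as [|k IH].
  - simpl. unfold kernel. assert (0 < 1 + s ^ 2) by nra. auto_derive.
    + repeat split; nra.
    + field. repeat split; nra.
  - cbn [moment]. assert (Hk := pos_INR k).
    assert (Hm : INR (4 * k) = 4 * INR k) by (rewrite mult_INR; simpl; ring).
    replace (4 * S k)%nat with (4 + 4 * k)%nat by lia.
    rewrite <- Hm. generalize dependent (4 * k)%nat. intros m IH Hm.
    assert (Hmon : is_derive (fun s => 2 * (s ^ (m + 1) / (INR m + 1)
               - 2 * (s ^ (m + 2) / (INR m + 2)) + s ^ (m + 3) / (INR m + 3))) s
             (2 * (s ^ m - 2 * s ^ (m + 1) + s ^ (m + 2)))).
    { auto_derive; [repeat split; lra|].
      replace (pred (m + 1)) with m by lia.
      replace (pred (m + 2)) with (m + 1)%nat by lia.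
      replace (pred (m + 3)) with (m + 2)%nat by lia.
      rewrite !plus_INR. simpl (INR 1). simpl (INR 2). simpl (INR 3).
      field. repeat split; lra. }
    evar_last; [apply (is_derive_minus (moment k)); [apply IH|apply Hmon]|].
    unfold minus, plus, opp, kernel; simpl.
    rewrite !pow_add. simpl. field. repeat split; nra.
Qed.

Lemma moment_at_0 k : moment k 0 = 0.
Proof.
  induction k as [|k IH]; cbn [moment].
  - replace (1 + 0 ^ 2) with 1 by ring. rewrite Rplus_0_r, ln_1. ring.
  - rewrite IH, !pow_ne_zero by lia. unfold Rdiv. ring.
Qed.

Lemma moment_at_1 k : moment k 1 = ln 2 - Hcomb k.
Proof.
  induction k as [|k IH]; cbn [moment].
  - rewrite Hcomb_0. replace (1 + 1 ^ 2) with 2 by ring. replace (1 + 1) with 2 by ring. ring.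
  - rewrite IH, Hcomb_S, !pow1. unfold Hcomb_step. assert (Hk := pos_INR k). field. lra.
Qed.

(** Domination by [|a k|] bounds the remainder of [b] by that of [|a|], hence
    uniformly in any parameter on which [b] depends. *)
Lemma series_tail_le (a b : nat -> R) (l : R) (N : nat) :
  ex_series (fun k => Rabs (a k)) -> is_series b l ->
  (forall k, Rabs (b k) <= Rabs (a k)) ->
  Rabs (l - sum_n b N) <= Series (fun k => Rabs (a k)) - sum_n (fun k => Rabs (a k)) N.
Proof.
  intros Ha Hb Hle.
  assert (B : forall m, Rabs (sum_n b (m + N) - sum_n b N)
     <= sum_n (fun k => Rabs (a k)) (m + N) - sum_n (fun k => Rabs (a k)) N).
  { induction m as [|m IH].
    - simpl. rewrite !Rminus_diag, Rabs_R0. lra.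
    - simpl (S m + N)%nat. rewrite !sum_Sn. unfold plus; simpl.
      assert (H := Hle (S (m + N))).
      assert (T := Rabs_triang (sum_n b (m + N) - sum_n b N) (b (S (m + N)))).
      replace (sum_n b (m + N) + b (S (m + N)) - sum_n b N)
        with (sum_n b (m + N) - sum_n b N + b (S (m + N))) by ring.
      lra. }
  assert (La := Series_correct _ Ha).
  refine (is_lim_seq_le _ _ (Rabs (l - sum_n b N)) (Series (fun k => Rabs (a k)) - _) B _ _).
  - apply (is_lim_seq_abs _ (l - sum_n b N)).
    apply (is_lim_seq_minus' _ _ l (sum_n b N)); [|apply is_lim_seq_const].
    now apply -> (is_lim_seq_incr_n (sum_n b) N l).
  - apply (is_lim_seq_minus' _ _ (Series (fun k => Rabs (a k)))); [|apply is_lim_seq_const].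
    now apply -> (is_lim_seq_incr_n (sum_n (fun k => Rabs (a k))) N).
Qed.

Lemma kernel_bound s : 0 <= s <= 1 -> Rabs (kernel s) <= 2.
Proof.
  intros Hs. unfold kernel.
  assert (1 <= (1 + s) * (1 + s ^ 2)) by nra.
  rewrite Rabs_pos_eq by (apply Rdiv_le_0_compat; lra).
  apply Rle_div_l; lra.
Qed.

(** Termwise integration along a path [s] from [0] to [1]: [F] is a primitive of the
    integrand obtained by summing [a k * s^(4k)] in closed form. The mean value theorem
    compares [F] with the primitives of the partial sums. Allowing a path instead of
    the segment itself makes it possible to integrate algebraic functions of [s] by
    a rational parametrization. *)
Lemma series_of_moments (a : nat -> R) (s ds G F : R -> R) (M : R) :
  ex_series (fun k => Rabs (a k)) ->
  s 0 = 0 -> s 1 = 1 ->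
  (forall v, 0 <= v <= 1 -> 0 <= s v <= 1) ->
  (forall v, 0 <= v <= 1 -> is_derive s v (ds v)) ->
  (forall v, 0 <= v <= 1 -> Rabs (ds v) <= M) ->
  (forall v, 0 <= v <= 1 -> is_series (fun k => a k * s v ^ (4 * k)) (G v)) ->
  (forall v, 0 <= v <= 1 -> is_derive F v (G v * kernel (s v) * ds v)) ->
  is_series (fun k => a k * moment k 1) (F 1 - F 0).
Proof.
  intros Ha Hs0 Hs1 Hs Hds HM HG HF.
  set (eps := fun N => Series (fun k => Rabs (a k)) - sum_n (fun k => Rabs (a k)) N).
  assert (Heps : is_lim_seq eps 0).
  { rewrite <- (Rminus_diag (Series (fun k => Rabs (a k)))).
    apply is_lim_seq_minus'; [apply is_lim_seq_const|]. apply (Series_correct _ Ha). }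
  assert (Hpart : forall N v, 0 <= v <= 1 ->
     is_derive (fun v => sum_n (fun k => a k * moment k (s v)) N) v
               (sum_n (fun k => a k * s v ^ (4 * k)) N * kernel (s v) * ds v)).
  { intros N v Hv.
    assert (Hk : forall k, is_derive (fun v => a k * moment k (s v)) v
                    (a k * s v ^ (4 * k) * kernel (s v) * ds v)).
    { intros k. evar_last.
      - apply is_derive_scal. apply (is_derive_comp (moment k) s).
        + apply moment_derive. now apply Hs.
        + now apply Hds.
      - unfold scal; simpl; unfold mult; simpl. ring. }
    induction N as [|N IH].
    - rewrite sum_O. eapply is_derive_ext; [|apply Hk]. intros; now rewrite sum_O.
    - rewrite sum_Sn. eapply is_derive_ext; [intros; symmetry; apply sum_Sn|].
      evar_last; [apply (is_derive_plus (V := R_NormedModule)); [apply IH|apply Hk]|].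
      unfold plus; simpl. ring. }
  assert (HN : forall N, Rabs (sum_n (fun k => a k * moment k 1) N - (F 1 - F 0)) <= 2 * M * eps N).
  { intros N.
    set (Phi := fun v => F v - sum_n (fun k => a k * moment k (s v)) N).
    assert (HP : forall v, 0 <= v <= 1 -> is_derive Phi v
      ((G v - sum_n (fun k => a k * s v ^ (4 * k)) N) * kernel (s v) * ds v)).
    { intros v Hv. evar_last; [apply (is_derive_minus F); [now apply HF|now apply Hpart]|].
      unfold minus, plus, opp; simpl. ring. }
    destruct (MVT_gen Phi 0 1 (fun v => (G v - sum_n (fun k => a k * s v ^ (4 * k)) N) * kernel (s v) * ds v)) as [v [Hv E]].
    - intros v Hv. apply HP. rewrite Rmin_left, Rmax_right in Hv; lra.
    - intros v Hv. rewrite Rmin_left, Rmax_right in Hv by lra.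
      apply derivable_continuous_pt. eexists. apply is_derive_Reals. now apply HP.
    - rewrite Rmin_left, Rmax_right in Hv by lra.
      unfold Phi in E. rewrite Hs0, Hs1 in E.
      rewrite (sum_n_ext (fun k => a k * moment k 0) (fun _ => 0)) in E
        by (intros; rewrite moment_at_0; apply Rmult_0_r).
      rewrite sum_n_const in E.
      replace (sum_n (fun k => a k * moment k 1) N - (F 1 - F 0))
        with (- (F 1 - sum_n (fun k => a k * moment k 1) N - (F 0 - INR (S N) * 0))) by ring.
      rewrite Rabs_Ropp, E, Rminus_0_r, Rmult_1_r, !Rabs_mult.
      assert (T : Rabs (G v - sum_n (fun k => a k * s v ^ (4 * k)) N) <= eps N).
      { apply series_tail_le; [assumption|now apply HG|].
        intros k. rewrite Rabs_mult. rewrite <- (Rmult_1_r (Rabs (a k))) at 2.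
        apply Rmult_le_compat_l; [apply Rabs_pos|].
        destruct (Hs v Hv). rewrite Rabs_pos_eq by now apply pow_le.
        rewrite <- (pow1 (4 * k)). apply pow_incr. lra. }
      assert (P1 := Rabs_pos (G v - sum_n (fun k => a k * s v ^ (4 * k)) N)).
      assert (P2 := Rabs_pos (kernel (s v))). assert (P3 := Rabs_pos (ds v)).
      assert (K := kernel_bound (s v) (Hs v Hv)). assert (D := HM v Hv).
      replace (2 * M * eps N) with (eps N * 2 * M) by ring.
      apply Rmult_le_compat; [apply Rmult_le_pos; lra|lra| |lra].
      apply Rmult_le_compat; lra. }
  assert (L : is_lim_seq (fun N => 2 * M * eps N) 0).
  { replace (Finite 0) with (Rbar_mult (2 * M) 0) by (simpl; now rewrite Rmult_0_r).
    now apply is_lim_seq_scal_l. }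
  assert (L2 : is_lim_seq (fun N => sum_n (fun k => a k * moment k 1) N - (F 1 - F 0)) 0).
  { apply is_lim_seq_abs_0.
    apply is_lim_seq_le_le with (fun _ => 0) (fun N => 2 * M * eps N); [|apply is_lim_seq_const|assumption].
    intros N; split; [apply Rabs_pos|apply HN]. }
  assert (L3 := is_lim_seq_plus' _ _ _ _ L2 (is_lim_seq_const (F 1 - F 0))).
  rewrite Rplus_0_l in L3.
  change (is_lim_seq (sum_n (fun k => a k * moment k 1)) (F 1 - F 0)).
  eapply is_lim_seq_ext; [|exact L3]. intros; simpl; ring.
Qed.

(** * Integration along a rational path *)

(* The normed-module type of the terms hides from field that they are real numbers *)
Ltac real_eq := match goal with |- @eq _ ?a ?b => change (@eq R a b) end.

Lemma is_series_Rscal (c : R) (a : nat -> R) (l : R) :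
  is_series a l -> is_series (fun k => c * a k) (c * l).
Proof. exact (is_series_scal_l (K := R_AbsRing) (V := R_NormedModule) c a l). Qed.

Lemma is_series_Rplus (a b : nat -> R) (la lb : R) :
  is_series a la -> is_series b lb -> is_series (fun k => a k + b k) (la + lb).
Proof. exact (is_series_plus (K := R_AbsRing) (V := R_NormedModule) a b la lb). Qed.

(** Quadratic polynomials in [k] over [(3k + 1) (3k + 2)], times [binom4 k], in the
    basis for which the generating functions are known; see [weighted_binom_eq]. *)
Definition weighted_binom (A0 A1 A2 : R) (k : nat) : R :=
  A0 * shifted_binom 0 k + A1 * shifted_binom 1 k + A2 * shifted_binom 2 k.

Lemma weighted_series A0 A1 A2 t : Rabs t < / 16 ->
  is_series (fun k => weighted_binom A0 A1 A2 k * (t * (1 - t) ^ 3) ^ k)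
    ((A0 + A1 / (1 - t) + A2 / (1 - t) ^ 2) / (1 - 4 * t)).
Proof.
  intros Ht. assert (Hz := small_root_bound t Ht).
  assert (Hb := Rabs_def2 _ _ Ht).
  assert (Hs : forall r, is_series (fun k => shifted_binom r k * (t * (1 - t) ^ 3) ^ k)
                  (/ ((1 - t) ^ r * (1 - 4 * t)))).
  { intros r. assert (E := shifted_sum_closed t r Ht).
    replace (/ ((1 - t) ^ r * (1 - 4 * t))) with (shifted_sum r (t * (1 - t) ^ 3)).
    - apply Series_correct. now apply ex_series_shifted.
    - rewrite Rinv_mult, <- E. field. apply pow_nonzero. lra. }
  assert (S := is_series_Rplus _ _ _ _ (is_series_Rplus _ _ _ _
     (is_series_Rscal A0 _ _ (Hs 0%nat)) (is_series_Rscal A1 _ _ (Hs 1%nat)))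
     (is_series_Rscal A2 _ _ (Hs 2%nat))).
  replace ((A0 + A1 / (1 - t) + A2 / (1 - t) ^ 2) / (1 - 4 * t)) with
    (A0 * / ((1 - t) ^ 0 * (1 - 4 * t)) + A1 * / ((1 - t) ^ 1 * (1 - 4 * t))
       + A2 * / ((1 - t) ^ 2 * (1 - 4 * t))) by (field; lra).
  eapply is_series_ext; [|exact S]. intros k. unfold weighted_binom. simpl. ring.
Qed.

Lemma ex_series_weighted_abs A0 A1 A2 z : Rabs z < / 10 ->
  ex_series (fun k => Rabs (weighted_binom A0 A1 A2 k * z ^ k)).
Proof.
  intros Hz.
  assert (H : forall A r, ex_series (fun k => Rabs A * Rabs (shifted_binom r k * z ^ k)))
    by (intros; now apply ex_series_Rscal, ex_series_shifted_abs).
  assert (S := ex_series_plus _ _ (ex_series_plus _ _ (H A0 0%nat) (H A1 1%nat)) (H A2 2%nat)).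
  eapply @ex_series_le; [|exact S].
  intros k. unfold norm, plus; simpl; unfold abs; simpl.
  rewrite Rabs_Rabsolu, <- !Rabs_mult. unfold weighted_binom.
  replace ((A0 * shifted_binom 0 k + A1 * shifted_binom 1 k + A2 * shifted_binom 2 k) * z ^ k)
    with (A0 * (shifted_binom 0 k * z ^ k) + A1 * (shifted_binom 1 k * z ^ k)
          + A2 * (shifted_binom 2 k * z ^ k)) by ring.
  eapply Rle_trans; [apply Rabs_triang|].
  apply Rplus_le_compat_r. apply Rabs_triang.
Qed.

(** The path [s = v / nu] solves the quartic explicitly: for [x = c^3 (1 - c)] one has
    [x s^4 = t (1 - t)^3] with [1 - t = c / nu]. The factor [1 - 4 t] in the denominator
    of the generating function equals [(4 c - 3 nu) / nu] and is cancelled by the same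
    factor of [ds/dv], so that the integrand has only the poles of the kernel. *)
Lemma weighted_moment_series A0 A1 A2 c F :
  Rabs (1 - c) < / 16 ->
  (forall v, 0 <= v <= 1 ->
     let nu := c + (1 - c) * v ^ 4 in
     is_derive F v ((A0 + A1 * nu / c + A2 * nu ^ 2 / c ^ 2)
                    * (2 * nu * (nu - v)) / ((nu + v) * (nu ^ 2 + v ^ 2)))) ->
  is_series (fun k => weighted_binom A0 A1 A2 k * (c ^ 3 * (1 - c)) ^ k * moment k 1) (F 1 - F 0).
Proof.
  intros Hc HF. assert (Hb := Rabs_def2 _ _ Hc).
  set (nu := fun v => c + (1 - c) * v ^ 4).
  assert (Hv4 : forall v, 0 <= v <= 1 -> 0 <= v ^ 4 <= 1).
  { intros v Hv. split; [apply pow_le; lra|]. rewrite <- (pow1 4). apply pow_incr. lra. }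
  assert (Hnu : forall v, 0 <= v <= 1 -> 15 / 16 < nu v < 17 / 16).
  { intros v Hv. assert (H4 := Hv4 v Hv). unfold nu. split; nra. }
  assert (Hle : forall v, 0 <= v <= 1 -> v <= nu v).
  { intros v Hv. assert (H4 := Hv4 v Hv). unfold nu.
    (* nu - v = (1 - v) - (1 - c) (1 - v^4), and 4 * |1 - c| < 1 *)
    assert (0 <= 1 - v ^ 4 <= 4 * (1 - v)).
    { split; [lra|]. replace (1 - v ^ 4) with ((1 - v) * (1 + v + v ^ 2 + v ^ 3)) by ring.
      rewrite (Rmult_comm 4). apply Rmult_le_compat_l; [lra|].
      assert (v ^ 2 <= 1 /\ v ^ 3 <= 1)
        by (split; rewrite <- (pow1 2) + rewrite <- (pow1 3); apply pow_incr; lra).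
      lra. }
    nra. }
  apply (series_of_moments _ (fun v => v / nu v) (fun v => (4 * c - 3 * nu v) / nu v ^ 2)
    (fun v => (A0 + A1 * nu v / c + A2 * nu v ^ 2 / c ^ 2) * nu v / (4 * c - 3 * nu v)) F 8).
  - apply ex_series_weighted_abs.
    replace (c ^ 3 * (1 - c)) with ((1 - c) * (1 - (1 - c)) ^ 3) by ring.
    now apply small_root_bound.
  - unfold Rdiv. ring.
  - unfold nu. field. lra.
  - intros v Hv. assert (N := Hnu v Hv). assert (L := Hle v Hv). split.
    + apply Rdiv_le_0_compat; lra.
    + apply Rle_div_l; lra.
  - intros v Hv. assert (N := Hnu v Hv). unfold nu in N |- *. auto_derive; [lra|].
    field. lra.
  - intros v Hv. assert (N := Hnu v Hv).
    assert (P : 0 < nu v ^ 2) by (apply pow_lt; lra).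
    unfold Rdiv. rewrite Rabs_mult, Rabs_inv, (Rabs_pos_eq (nu v ^ 2)) by lra.
    apply Rle_div_l; [assumption|]. apply Rabs_le. split; nra.
  - intros v Hv. assert (N := Hnu v Hv). assert (H4 := Hv4 v Hv).
    assert (Ht : Rabs (1 - c / nu v) < / 16).
    { replace (1 - c / nu v) with ((1 - c) * (v ^ 4 / nu v)) by (unfold nu in *; field; lra).
      rewrite Rabs_mult.
      assert (Q : 0 <= v ^ 4 / nu v <= 1).
      { split; [apply Rdiv_le_0_compat; lra|]. apply Rle_div_l; [lra|]. unfold nu.
        nra. }
      rewrite (Rabs_pos_eq (v ^ 4 / nu v)) by lra.
      assert (0 <= Rabs (1 - c)) by apply Rabs_pos. nra. }
    assert (S := weighted_series A0 A1 A2 _ Ht).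
    replace ((A0 + A1 * nu v / c + A2 * nu v ^ 2 / c ^ 2) * nu v / (4 * c - 3 * nu v))
      with ((A0 + A1 / (1 - (1 - c / nu v)) + A2 / (1 - (1 - c / nu v)) ^ 2)
            / (1 - 4 * (1 - c / nu v))) by (field; lra).
    eapply is_series_ext; [|exact S]. intros k. cbv beta.
    rewrite Rmult_assoc, pow_mult, <- Rpow_mult_distr. f_equal. f_equal.
    unfold nu in *. field. lra.
  - intros v Hv. assert (N := Hnu v Hv).
    evar_last; [now apply HF|]. fold (nu v). cbv zeta.
    change (c + (1 - c) * v ^ 4) with (nu v). unfold kernel.
    field. repeat split; try lra; nra.
Qed.

(** * The primitive and its values *)

Lemma weighted_binom_eq A0 A1 A2 k :
  weighted_binom A0 A1 A2 k
  = binom4 k * (A0 * ((3 * INR k + 1) * (3 * INR k + 2))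
                + A1 * ((4 * INR k + 1) * (3 * INR k + 2))
                + A2 * ((4 * INR k + 1) * (4 * INR k + 2)))
    / ((3 * INR k + 1) * (3 * INR k + 2)).
Proof.
  assert (Hk := pos_INR k).
  assert (E1 := shifted_binom_S 0 k). assert (E2 := shifted_binom_S 1 k).
  unfold weighted_binom. rewrite shifted_binom_0 in *.
  simpl (INR 0) in E1. simpl (INR 1) in E2.
  replace (shifted_binom 2 k) with (shifted_binom 1 k * (4 * INR k + 2) / (3 * INR k + 2))
    by (field_simplify_eq; lra).
  replace (shifted_binom 1 k) with (binom4 k * (4 * INR k + 1) / (3 * INR k + 1))
    by (field_simplify_eq; lra).
  field. lra.
Qed.

(** A root of unity [s = -1] or [s = +-i] has [s^4 = 1], so the poles of the kernel lie over
    the same value [x] as the endpoint [s = 1], and the residues are values of the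
    generating function at the conjugate roots of the quartic. With [q = modulus g] and
    [y = (q^2 - 1) / 4], for every root [t] of [t (1 - t)^3 = x] the number [w = y / (1 - t)] is a
    root of
    [w^4 - q^2 w + q^2 y = (w^2 - q w + q (q - 1) / 2) (w^2 + q w + q (q + 1) / 2)],
    and the root of the first factor that belongs to the endpoint, [w = q (1 - g) / 2], is
    rational in [g]. *)
Definition modulus (g : R) : R := 2 / (1 + g ^ 2).

(** The value of [1 - t] at the endpoint [s = 1]: then [t = (1 - g)^3 / (4 (1 + g^2))], and
    [t (1 - t)^3 = (d - 1)^3 / (64 d)] for [d = modulus g ^ 2]. *)
Definition path_ratio (g : R) : R := (1 + g) * (3 + g ^ 2) / (4 * (1 + g ^ 2)).

(** The logarithmic part of the primitive. The arguments of the first two logarithms are, up to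
    constants, the quadratic factors of [nu + v] (the pole [s = -1]), those of the last two are
    the real quartic factors of [nu^2 + v^2] (the poles [s = +-i]). *)
Definition log_part (g v : R) : R :=
  2 * ln ((1 - g) * v ^ 2 + 2 * v + (1 + g))
  - 2 * ln ((1 - g) ^ 2 * v ^ 2 - 2 * (1 - g) * v + (3 + g ^ 2))
  - ln (((1 + g) - (1 - g) * v ^ 2) ^ 2 + 4 * v ^ 2)
  + ln (((3 + g ^ 2) - (1 - g) ^ 2 * v ^ 2) ^ 2 + 4 * (1 - g) ^ 2 * v ^ 2).

(** The polynomial part of the primitive, which comes from the pole of the integrand at
    [v = infinity]. *)
Definition rat_part (g v : R) : R :=
  let b := (1 - g) / (1 + g ^ 2) in
  let y := (modulus g ^ 2 - 1) / 4 in
  - 16 * (y * (b * v) + (b * v) ^ 5 / (5 * modulus g ^ 2)) - 16 * (b * v) + 16 * (b * v) ^ 2.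

(** The coefficients [4 d, 2 (1 - d), - (1 - d)^2 / 2] are those for which the generating function
    takes the values [+- 4 q] at the four conjugate roots; all residues are then [q] times a
    rational number, which leaves no nested radical outside the logarithms. *)
Lemma primitive_derive g v : 0 < g -> 0 <= v <= 1 ->
  let q := modulus g in
  let c := path_ratio g in
  let nu := c + (1 - c) * v ^ 4 in
  is_derive (fun v => 4 * q * log_part g v + rat_part g v) v
    ((4 * q ^ 2 + 2 * (1 - q ^ 2) * nu / c + - (1 - q ^ 2) ^ 2 / 2 * nu ^ 2 / c ^ 2)
     * (2 * nu * (nu - v)) / ((nu + v) * (nu ^ 2 + v ^ 2))).
Proof.
  intros Hg Hv q c nu.
  set (b := (1 - g) / (1 + g ^ 2)).
  unfold modulus in q. unfold path_ratio in c.
  set (P1 := (1 - g) * v ^ 2 + 2 * v + (1 + g)).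
  set (P2 := (1 - g) ^ 2 * v ^ 2 - 2 * (1 - g) * v + (3 + g ^ 2)).
  set (R1 := ((1 + g) - (1 - g) * v ^ 2) ^ 2 + 4 * v ^ 2).
  set (R2 := ((3 + g ^ 2) - (1 - g) ^ 2 * v ^ 2) ^ 2 + 4 * (1 - g) ^ 2 * v ^ 2).
  assert (Hg2 : 0 < 1 + g ^ 2) by nra.
  assert (HP1 : 0 < P1).
  { unfold P1. assert (0 <= g * (1 - v ^ 2)) by (apply Rmult_le_pos; nra). nra. }
  assert (HP2 : 0 < P2).
  { unfold P2. replace (_ + _) with (((1 - g) * v - 1) ^ 2 + (2 + g ^ 2)) by ring.
    assert (0 <= ((1 - g) * v - 1) ^ 2) by apply pow2_ge_0. nra. }
  assert (HR1 : 0 < R1).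
  { unfold R1. assert (0 <= (1 + g - (1 - g) * v ^ 2) ^ 2) by apply pow2_ge_0.
    destruct (Req_dec v 0) as [->|]; [|nra]. nra. }
  assert (HR2 : 0 < R2).
  { unfold R2. assert (0 <= (3 + g ^ 2 - (1 - g) ^ 2 * v ^ 2) ^ 2) by apply pow2_ge_0.
    assert (0 <= (1 - g) ^ 2) by apply pow2_ge_0. assert (0 <= v ^ 2) by apply pow2_ge_0.
    assert (0 <= (1 - g) ^ 2 * v ^ 2) by now apply Rmult_le_pos.
    destruct (Req_dec ((1 - g) ^ 2 * v ^ 2) 0) as [E|]; [|nra].
    rewrite Rmult_assoc, E. nra. }
  assert (HD : is_derive (fun v => 4 * q * log_part g v + rat_part g v) v
    (4 * q * (2 * ((2 * (1 - g) * v + 2) / P1)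
              - 2 * ((2 * (1 - g) ^ 2 * v - 2 * (1 - g)) / P2)
              - (- 4 * (1 - g) * v * (1 + g - (1 - g) * v ^ 2) + 8 * v) / R1
              + (- 4 * (1 - g) ^ 2 * v * (3 + g ^ 2 - (1 - g) ^ 2 * v ^ 2) + 8 * (1 - g) ^ 2 * v) / R2)
     + (- 16 * b ^ 2 * nu - 16 * b + 32 * b ^ 2 * v))).
  { unfold log_part, rat_part, modulus. fold q b. auto_derive.
    - repeat split; try assumption; fold P1 P2 R1 R2; unfold P1, P2, R1, R2 in *; lra.
    - replace (-16 * b ^ 2 * nu) with (-16 * b * ((q ^ 2 - 1) / 4 + b ^ 4 * v ^ 4 / q ^ 2))
        by (unfold b, nu, q, c; field; lra).
      assert (Hq : q <> 0) by (unfold q; apply Rgt_not_eq, Rdiv_lt_0_compat; lra).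
      unfold P1, P2, R1, R2 in *. field. repeat split; try lra. }
  evar_last; [exact HD|].
  replace (2 * (1 - q ^ 2) * nu / c) with (- 8 * b * nu)
    by (unfold q, b, c; field; repeat split; nra).
  replace (- (1 - q ^ 2) ^ 2 / 2 * nu ^ 2 / c ^ 2) with (- 8 * b ^ 2 * nu ^ 2)
    by (unfold q, b, c; field; repeat split; nra).
  (* The factorizations over the field generated by g that make the logarithms elementary *)
  replace (nu + v) with (P1 * P2 / (4 * (1 + g ^ 2)))
    by (unfold nu, c, P1, P2; field; lra).
  replace (nu ^ 2 + v ^ 2) with (R1 * R2 / (16 * (1 + g ^ 2) ^ 2))
    by (unfold nu, c, R1, R2; field; lra).
  assert (Enu : nu = ((1 + g) * (3 + g ^ 2) + (1 - g) ^ 3 * v ^ 4) / (4 * (1 + g ^ 2)))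
    by (unfold nu, c; field; lra).
  rewrite Enu. unfold q, b.
  assert (E1 : P1 = (1 - g) * v ^ 2 + 2 * v + (1 + g)) by reflexivity.
  assert (E2 : P2 = (1 - g) ^ 2 * v ^ 2 - 2 * (1 - g) * v + (3 + g ^ 2)) by reflexivity.
  assert (E3 : R1 = ((1 + g) - (1 - g) * v ^ 2) ^ 2 + 4 * v ^ 2) by reflexivity.
  assert (E4 : R2 = ((3 + g ^ 2) - (1 - g) ^ 2 * v ^ 2) ^ 2 + 4 * (1 - g) ^ 2 * v ^ 2) by reflexivity.
  clearbody P1 P2 R1 R2. clear - HP1 HP2 HR1 HR2 Hg2 E1 E2 E3 E4.
  field_simplify_eq; [|repeat split; nra].
  rewrite E1, E2, E3, E4. ring.
Qed.

Lemma log_part_at_0 g : 0 < g -> log_part g 0 = 0.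
Proof.
  intros Hg.
  unfold log_part.
  replace ((1 - g) * 0 ^ 2 + 2 * 0 + (1 + g)) with (1 + g) by ring.
  replace ((1 - g) ^ 2 * 0 ^ 2 - 2 * (1 - g) * 0 + (3 + g ^ 2)) with (3 + g ^ 2) by ring.
  replace ((1 + g - (1 - g) * 0 ^ 2) ^ 2 + 4 * 0 ^ 2) with ((1 + g) * (1 + g)) by ring.
  replace ((3 + g ^ 2 - (1 - g) ^ 2 * 0 ^ 2) ^ 2 + 4 * (1 - g) ^ 2 * 0 ^ 2)
    with ((3 + g ^ 2) * (3 + g ^ 2)) by ring.
  rewrite !ln_mult by nra. ring.
Qed.

(** The nested radicals cancel between the two kinds of poles. *)
Lemma log_part_at_1 g : log_part g 1 = ln 2 + ln (modulus g ^ 2).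
Proof.
  assert (Hg2 : 0 < 1 + g ^ 2) by nra.
  unfold log_part, modulus.
  replace ((1 - g) * 1 ^ 2 + 2 * 1 + (1 + g)) with (2 * 2) by ring.
  replace ((1 - g) ^ 2 * 1 ^ 2 - 2 * (1 - g) * 1 + (3 + g ^ 2)) with (2 * (1 + g ^ 2)) by ring.
  replace ((1 + g - (1 - g) * 1 ^ 2) ^ 2 + 4 * 1 ^ 2) with (2 * (2 * (1 + g ^ 2))) by ring.
  replace ((3 + g ^ 2 - (1 - g) ^ 2 * 1 ^ 2) ^ 2 + 4 * (1 - g) ^ 2 * 1 ^ 2)
    with (2 * (2 * (2 * (1 + g ^ 2)))) by ring.
  replace ((2 / (1 + g ^ 2)) ^ 2) with (2 * 2 * (/ (1 + g ^ 2) * / (1 + g ^ 2))) by (field; lra).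
  assert (0 < / (1 + g ^ 2)) by now apply Rinv_0_lt_compat.
  rewrite !ln_mult, ln_Rinv by (try apply Rmult_lt_0_compat; lra). ring.
Qed.

Lemma ratio_in_disc g : 0 < g -> Rabs ((1 - g) ^ 3) < (1 + g ^ 2) / 4 ->
  Rabs (1 - path_ratio g) < / 16.
Proof.
  intros Hg H. unfold path_ratio. assert (Hg2 : 0 < 1 + g ^ 2) by nra.
  replace (1 - (1 + g) * (3 + g ^ 2) / (4 * (1 + g ^ 2)))
    with ((1 - g) ^ 3 / (4 * (1 + g ^ 2))) by (field; lra).
  unfold Rdiv. rewrite Rabs_mult, Rabs_inv, (Rabs_pos_eq (4 * (1 + g ^ 2))) by lra.
  apply Rlt_div_l; lra.
Qed.

(** The quadratic weight is, over [(3k + 1) (3k + 2)], the combination of shifted binomials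
    with the coefficients of [primitive_derive]. *)
Definition quad (d k : R) : R :=
  4 * (4 - d) * (1 + 2 * d) * k ^ 2 + (16 + 26 * d - 6 * d ^ 2) * k + (3 + 6 * d - d ^ 2).

(** The linear weight compensates [rat_part] at the endpoint. *)
Definition lin (d k : R) : R := 4 * (1 - d) * (4 - d) * k + 8 * (1 - d).

(** The real number [q] is [modulus g] for some [g] for which the root [t] at the endpoint
    satisfies [|t| < 1/16]. The parameter [g] is a nested radical when [q] is a square root of
    a rational number. *)
Definition admissible (q : R) : Prop :=
  exists g, 0 < g /\ q = modulus g /\ Rabs ((1 - g) ^ 3) < (1 + g ^ 2) / 4.

Definition argument (d : R) : R := (d - 1) ^ 3 / (64 * d).

Lemma argument_eq g : 0 < g ->
  argument (modulus g ^ 2) = path_ratio g ^ 3 * (1 - path_ratio g).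
Proof. intros Hg. unfold argument, path_ratio, modulus. field. nra. Qed.

Lemma weighted_series_at_end g A0 A1 A2 :
  0 < g -> Rabs ((1 - g) ^ 3) < (1 + g ^ 2) / 4 ->
  let c := path_ratio g in
  is_series (fun k => weighted_binom A0 A1 A2 k * argument (modulus g ^ 2) ^ k)
    ((A0 + A1 / c + A2 / c ^ 2) / (4 * c - 3)).
Proof.
  intros Hg Hsmall c. assert (Ht := ratio_in_disc g Hg Hsmall).
  rewrite argument_eq by assumption. fold c in Ht |- *.
  assert (S := weighted_series A0 A1 A2 _ Ht).
  replace (1 - (1 - c)) with c in S by ring.
  replace (1 - 4 * (1 - c)) with (4 * c - 3) in S by ring.
  now rewrite (Rmult_comm (c ^ 3)).
Qed.

Lemma end_discriminant g : 0 < g ->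
  4 * path_ratio g - 3 = g * (3 + g ^ 2 - 2 * g) / (1 + g ^ 2).
Proof. intros Hg. unfold path_ratio. field. nra. Qed.

Lemma quad_series q d : admissible q -> q ^ 2 = d ->
  is_series (fun k => binom4 k * quad d (INR k) / ((3 * INR k + 1) * (3 * INR k + 2))
                      * argument d ^ k)
    (4 * q).
Proof.
  intros [g [Hg [-> Hsmall]]] <-. set (d := modulus g ^ 2).
  assert (S := weighted_series_at_end g (4 * d) (2 * (1 - d)) (- (1 - d) ^ 2 / 2) Hg Hsmall).
  cbv zeta in S. fold d in S.
  evar_last.
  - eapply is_series_ext; [|exact S]. intros k. real_eq. cbv beta.
    rewrite weighted_binom_eq. f_equal.
    assert (Hk := pos_INR k). unfold quad. field. lra.
  - rewrite end_discriminant by assumption. unfold d, path_ratio, modulus.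
    field. repeat split; nra.
Qed.

(** By [moment_at_1] the harmonic sum is [ln 2] times the plain sum [4 q] minus the moment sum,
    and the [ln 2] of [log_part_at_1] cancels the first term. *)
Lemma harmonic_quad_series q d : admissible q -> q ^ 2 = d ->
  is_series (fun k => binom4 k * (quad d (INR k) * Hcomb k + lin d (INR k))
                      / ((3 * INR k + 1) * (3 * INR k + 2)) * argument d ^ k)
    (- 4 * q * ln d).
Proof.
  intros Hadm Hd. assert (S2 := is_series_Rscal (ln 2) _ _ (quad_series q d Hadm Hd)).
  destruct Hadm as [g [Hg [-> Hsmall]]]. subst d. set (d := modulus g ^ 2) in *.
  set (c := path_ratio g).
  assert (Hc := ratio_in_disc g Hg Hsmall). fold c in Hc.
  assert (S1 := weighted_moment_series (4 * d) (2 * (1 - d)) (- (1 - d) ^ 2 / 2) c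
    (fun v => 4 * modulus g * log_part g v + rat_part g v) Hc
    (fun v Hv => primitive_derive g v Hg Hv)).
  cbv beta in S1. rewrite log_part_at_1, log_part_at_0 in S1 by assumption. fold d in S1.
  (* lin d over (3k+1)(3k+2), decomposed on the basis of weighted_binom *)
  set (e0 := 16 * (1 - d) * (4 + d) / 5).
  set (e2 := - 12 / 5 * (1 - d) ^ 2).
  assert (S3 := weighted_series_at_end g e0 (4 * (1 - d) - e0 - e2) e2 Hg Hsmall).
  cbv zeta in S3. fold d in S3.
  assert (S := is_series_Rplus _ _ _ _
    (is_series_Rplus _ _ _ _ S2 (is_series_Rscal (-1) _ _ S1)) S3).
  evar_last.
  - eapply is_series_ext; [|exact S]. intros k. real_eq. cbv beta.
    unfold c. rewrite <- argument_eq by assumption. fold d.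
    rewrite moment_at_1, !weighted_binom_eq.
    assert (Hk := pos_INR k). unfold quad, lin, e0, e2. field. lra.
  - cbv beta. rewrite end_discriminant by assumption.
    generalize (ln 2) (ln d). intros l2 l.
    unfold rat_part, e0, e2, d, path_ratio, modulus. field. repeat split; nra.
Qed.

(** * Telescoping *)

Lemma telescoping_series (T : nat -> R) :
  is_lim_seq T 0 -> is_series (fun k => T (S k) - T k) (- T 0%nat).
Proof.
  intros HT.
  change (is_lim_seq (sum_n (fun k => T (S k) - T k)) (- T 0%nat)).
  apply is_lim_seq_ext with (fun n => T (S n) - T 0%nat).
  - induction n as [|n IH]; [now rewrite sum_O|].
    rewrite sum_Sn, <- IH. unfold plus; simpl. ring.
  - rewrite <- Rminus_0_l. apply is_lim_seq_minus'; [|apply is_lim_seq_const].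
    now apply -> is_lim_seq_incr_1.
Qed.

(** [k * (9/10)^k] is bounded by Bernoulli's inequality, and [1/2 < (9/10)^6]. *)
Lemma cubic_pow_half_le k : INR k ^ 3 * (/ 2) ^ k <= 729 * (729 / 1000) ^ k.
Proof.
  assert (Hk := pos_INR k).
  assert (B : INR k * (9 / 10) ^ k <= 9).
  { assert (P : 0 < (9 / 10) ^ k) by (apply pow_lt; lra).
    assert (Bern := poly k (/ 9) ltac:(lra)).
    assert (E : (1 + / 9) ^ k * (9 / 10) ^ k = 1).
    { rewrite <- Rpow_mult_distr. replace ((1 + / 9) * (9 / 10)) with 1 by field. apply pow1. }
    assert ((1 + INR k * / 9) * (9 / 10) ^ k <= 1) by (rewrite <- E; apply Rmult_le_compat_r; lra).
    lra. }
  assert (P : 0 <= (9 / 10) ^ k) by (apply pow_le; lra).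
  apply Rle_trans with (INR k ^ 3 * (531441 / 1000000) ^ k).
  - apply Rmult_le_compat_l; [now apply pow_le|]. apply pow_incr. lra.
  - replace (531441 / 1000000) with ((9 / 10) * (9 / 10) * (9 / 10) * (729 / 1000)) by field.
    rewrite !Rpow_mult_distr.
    replace (INR k ^ 3 * ((9 / 10) ^ k * (9 / 10) ^ k * (9 / 10) ^ k * (729 / 1000) ^ k))
      with ((INR k * (9 / 10) ^ k) ^ 3 * (729 / 1000) ^ k) by ring.
    apply Rmult_le_compat_r; [apply pow_le; lra|].
    replace 729 with (9 ^ 3) by ring. apply pow_incr. split; [now apply Rmult_le_pos|assumption].
Qed.

Definition telescoper (al be de x : R) (k : nat) : R :=
  binom4 k * x ^ k * (INR k * ((al * INR k + be) * Hcomb k + de)).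

Lemma telescoper_S al be de x k :
  telescoper al be de x (S k)
  = binom4 k * (8 * (4 * INR k + 3) * (2 * INR k + 1) * (4 * INR k + 1))
    / (3 * (3 * INR k + 1) * (3 * INR k + 2)) * (x * x ^ k)
    * ((al * (INR k + 1) + be) * (Hcomb k + Hcomb_step k) + de).
Proof.
  assert (Hk := pos_INR k). assert (E := binom4_S k).
  unfold telescoper. rewrite Hcomb_S, S_INR.
  replace (binom4 (S k)) with (binom4 k * (8 * (4 * INR k + 3) * (2 * INR k + 1) * (4 * INR k + 1))
    / (3 * (INR k + 1) * (3 * INR k + 1) * (3 * INR k + 2)))
    by (apply Rmult_eq_reg_r with (3 * (INR k + 1) * (3 * INR k + 1) * (3 * INR k + 2));
        [rewrite E; field; lra|repeat apply Rmult_integral_contrapositive_currified; lra]).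
  simpl pow. field. lra.
Qed.

Lemma telescoper_lim al be de x : Rabs x <= / 20 -> is_lim_seq (telescoper al be de x) 0.
Proof.
  intros Hx.
  set (K := 2 * Rabs al + 2 * Rabs be + Rabs de).
  assert (HK : 0 <= K).
  { assert (A := Rabs_pos al). assert (B := Rabs_pos be). assert (D := Rabs_pos de). unfold K. lra. }
  apply is_lim_seq_abs_0.
  apply is_lim_seq_le_le with (fun _ => 0) (fun k => K * 729 * (729 / 1000) ^ k).
  - intros k. split; [apply Rabs_pos|].
    assert (Hk := pos_INR k). unfold telescoper. rewrite !Rabs_mult.
    assert (Hb : Rabs (binom4 k) * Rabs (x ^ k) <= (/ 2) ^ k).
    { assert (P := shifted_binom_pos 0 k). rewrite shifted_binom_0 in P.
      rewrite Rabs_pos_eq, <- RPow_abs by lra.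
      replace (/ 2) with (10 * / 20) by field. rewrite Rpow_mult_distr.
      apply Rmult_le_compat; [lra|apply pow_le, Rabs_pos|apply binom4_le|].
      apply pow_incr. split; [apply Rabs_pos|assumption]. }
    assert (Hp : Rabs (INR k) * Rabs ((al * INR k + be) * Hcomb k + de) <= K * INR k ^ 3).
    { rewrite (Rabs_pos_eq (INR k)) by lra.
      destruct k as [|k]; [simpl; lra|].
      assert (H1 : 1 <= INR (S k)) by (rewrite S_INR; assert (P := pos_INR k); lra).
      assert (HH := Hcomb_bound (S k)). set (n := INR (S k)) in *. set (h := Hcomb (S k)) in *.
      replace (K * n ^ 3) with (n * (K * n ^ 2)) by ring.
      apply Rmult_le_compat_l; [lra|].
      eapply Rle_trans; [apply Rabs_triang|]. rewrite Rabs_mult, (Rabs_pos_eq h) by lra.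
      assert (T := Rabs_triang (al * n) be). rewrite Rabs_mult, (Rabs_pos_eq n) in T by lra.
      assert (A := Rabs_pos al). assert (B := Rabs_pos be). assert (D := Rabs_pos de).
      assert (S1 : Rabs (al * n + be) * h <= (Rabs al * n + Rabs be) * (2 * n)).
      { apply Rmult_le_compat; [apply Rabs_pos|lra|exact T|lra]. }
      assert (n <= n ^ 2) by nra. assert (1 <= n ^ 2) by nra.
      assert (Rabs be * n <= Rabs be * n ^ 2) by (apply Rmult_le_compat_l; lra).
      assert (Rabs de * 1 <= Rabs de * n ^ 2) by (apply Rmult_le_compat_l; lra).
      unfold K. lra. }
    apply Rle_trans with ((/ 2) ^ k * (K * INR k ^ 3)).
    + apply Rmult_le_compat; try assumption; apply Rmult_le_pos; apply Rabs_pos.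
    + assert (C := cubic_pow_half_le k).
      replace ((/ 2) ^ k * (K * INR k ^ 3)) with (K * (INR k ^ 3 * (/ 2) ^ k)) by ring.
      rewrite (Rmult_assoc K). now apply Rmult_le_compat_l.
  - apply is_lim_seq_const.
  - replace (Finite 0) with (Rbar_mult (K * 729) 0) by (simpl; now rewrite Rmult_0_r).
    apply is_lim_seq_scal_l, is_lim_seq_geom. rewrite Rabs_pos_eq; lra.
Qed.

(** A telescoping series with the same hypergeometric term raises the degree of the polynomial
    weight, and so transports [harmonic_quad_series] to weights without the
    denominator [(3k + 1) (3k + 2)]; the harmonic-free terms that arise are corrected by a
    multiple of [quad_series]. *)
Lemma harmonic_telescoped_series q mu nu al be de d :
  admissible q -> q ^ 2 = d -> Rabs (argument d) <= / 20 ->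
  is_series (fun k =>
      mu * (binom4 k * (quad d (INR k) * Hcomb k + lin d (INR k))
            / ((3 * INR k + 1) * (3 * INR k + 2)) * argument d ^ k)
      + nu * (binom4 k * quad d (INR k) / ((3 * INR k + 1) * (3 * INR k + 2))
              * argument d ^ k)
      + (telescoper al be de (argument d) (S k) - telescoper al be de (argument d) k))
    (4 * q * (nu - mu * ln d)).
Proof.
  intros Hadm Hd Hx.
  replace (4 * q * (nu - mu * ln d))
    with (mu * (- 4 * q * ln d) + nu * (4 * q) + - telescoper al be de (argument d) 0)
    by (unfold telescoper; simpl; ring).
  apply is_series_Rplus; [apply is_series_Rplus; apply is_series_Rscal|].
  - now apply harmonic_quad_series.
  - now apply quad_series.
  - now apply telescoping_series, telescoper_lim.
Qed.

(** * The five parameters *)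

(** The parameter is [g = sqrt (2 / q - 1)], located between [lo] and [hi]. *)
Lemma admissible_between q lo hi B :
  0 < q -> 0 < lo -> 0 < hi -> q * (1 + lo ^ 2) <= 2 <= q * (1 + hi ^ 2) ->
  1 - lo <= B -> hi - 1 <= B -> B ^ 3 < (1 + lo ^ 2) / 4 -> admissible q.
Proof.
  intros Hq Hlo Hhi [H1 H2] B1 B2 B3.
  set (g := sqrt (2 / q - 1)). exists g.
  assert (L : lo ^ 2 <= 2 / q - 1).
  { assert (1 + lo ^ 2 <= 2 / q) by (apply Rle_div_r; lra). lra. }
  assert (U : 2 / q - 1 <= hi ^ 2).
  { assert (2 / q <= 1 + hi ^ 2) by (apply Rle_div_l; lra). lra. }
  assert (0 < lo ^ 2) by (apply pow_lt; lra).
  assert (G2 : g ^ 2 = 2 / q - 1) by (apply pow2_sqrt; lra).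
  assert (Glo : lo <= g) by (rewrite <- (sqrt_pow2 lo) by lra; apply sqrt_le_1_alt, L).
  assert (Ghi : g <= hi) by (rewrite <- (sqrt_pow2 hi) by lra; apply sqrt_le_1_alt, U).
  repeat split; [lra|unfold modulus; rewrite G2; field; lra|].
  rewrite <- RPow_abs.
  apply Rle_lt_trans with (B ^ 3).
  - apply pow_incr. split; [apply Rabs_pos|]. apply Rabs_le; lra.
  - rewrite G2. lra.
Qed.

Lemma sqrt_between n lo hi : 0 <= lo -> 0 <= hi -> lo ^ 2 <= n <= hi ^ 2 -> lo <= sqrt n <= hi.
Proof.
  intros Hlo Hhi [H1 H2].
  split; [rewrite <- (sqrt_pow2 lo)|rewrite <- (sqrt_pow2 hi)]; try apply sqrt_le_1_alt; lra.
Qed.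

Lemma admissible_half : admissible (/ sqrt 2).
Proof.
  destruct (sqrt_between 2 (141/100) (142/100)) as [L U]; [lra..|].
  assert (P : 0 < / sqrt 2) by (apply Rinv_0_lt_compat; lra).
  apply (admissible_between _ (13/10) (14/10) (4/10)); try lra.
  split; rewrite Rmult_comm; [apply Rle_div_l|apply Rle_div_r]; lra.
Qed.

Lemma admissible_two : admissible (sqrt 2).
Proof.
  destruct (sqrt_between 2 (141/100) (142/100)) as [L U]; [lra..|].
  apply (admissible_between _ (6/10) (7/10) (4/10)); lra.
Qed.

Lemma admissible_third : admissible (/ sqrt 3).
Proof.
  destruct (sqrt_between 3 (173/100) (174/100)) as [L U]; [lra..|].
  assert (P : 0 < / sqrt 3) by (apply Rinv_0_lt_compat; lra).
  apply (admissible_between _ (15/10) (16/10) (6/10)); try lra.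
  split; rewrite Rmult_comm; [apply Rle_div_l|apply Rle_div_r]; lra.
Qed.

Lemma admissible_fifth : admissible (/ sqrt 5).
Proof.
  destruct (sqrt_between 5 (223/100) (224/100)) as [L U]; [lra..|].
  assert (P : 0 < / sqrt 5) by (apply Rinv_0_lt_compat; lra).
  apply (admissible_between _ (18/10) (19/10) (9/10)); try lra.
  split; rewrite Rmult_comm; [apply Rle_div_l|apply Rle_div_r]; lra.
Qed.

Lemma admissible_three : admissible (sqrt 3).
Proof.
  destruct (sqrt_between 3 (1732/1000) (1733/1000)) as [L U]; [lra..|].
  apply (admissible_between _ (39/100) (40/100) (61/100)); lra.
Qed.

(** * The identities *)

Lemma inv_sqrt_sq n : 0 < n -> (/ sqrt n) ^ 2 = / n.
Proof. intros Hn. rewrite pow_inv, pow2_sqrt by lra. reflexivity. Qed.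

Lemma inv_sqrt n : 0 < n -> / sqrt n = sqrt n / n.
Proof.
  intros Hn. assert (0 < sqrt n) by now apply sqrt_lt_R0.
  rewrite <- (sqrt_sqrt n) at 3 by lra. field. lra.
Qed.

Ltac same_terms X :=
  let k := fresh "k" in
  intros k; real_eq; cbv beta; rewrite ?telescoper_S;
  unfold telescoper, quad, lin, Hcomb_step;
  assert (Hk := pos_INR k);
  rewrite (pow_inv X k);
  assert (HX : X ^ k <> 0) by (apply pow_nonzero; lra);
  field; repeat split; first [exact HX | lra].

Ltac square_of_parameter := first [apply pow2_sqrt; lra | apply inv_sqrt_sq; lra].

Ltac by_telescoping mu nu al be de d X adm :=
  let E := fresh "E" in
  assert (E : argument d = / X) by (unfold argument; field);
  evar_last;
  [ eapply is_series_ext;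
    [| apply (harmonic_telescoped_series _ mu nu al be de d adm);
       [square_of_parameter | rewrite E; apply Rabs_le; lra]];
    rewrite E; same_terms X
  |].

Ltac by_scaling lam d X adm :=
  let E := fresh "E" in
  assert (E : argument d = / X) by (unfold argument; field);
  evar_last;
  [ eapply is_series_ext;
    [| apply (is_series_Rscal lam), (harmonic_quad_series _ d adm); square_of_parameter];
    rewrite E; same_terms X
  |].

Theorem theorem1p3 :
  is_series (fun k : nat =>
      binom4 k
        * ((224 * INR k ^ 2 - 86 * INR k + 1) * Hcomb k + 182 * INR k + 5)
        / (-256) ^ k)
    ((9 - 5 * ln 2) / (4 * sqrt 2))
  /\
  is_series (fun k : nat =>
      binom4 k
        * ((112 * INR k ^ 2 + 110 * INR k + 23) * Hcomb k + 28 * INR k + 16)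
        / ((3 * INR k + 1) * (3 * INR k + 2) * (-256) ^ k))
    (8 * sqrt 2 * ln 2)
  /\
  is_series (fun k : nat =>
      binom4 k
        * ((200 * INR k ^ 2 + 76 * INR k - 17) * Hcomb k - 8 * (725 * INR k - 49))
        / 128 ^ k)
    (sqrt 2 * (144 + 5 * ln 2))
  /\
  is_series (fun k : nat =>
      binom4 k
        * ((40 * INR k ^ 2 + 44 * INR k + 11) * Hcomb k - 8 * (INR k + 1))
        / ((3 * INR k + 1) * (3 * INR k + 2) * 128 ^ k))
    (- 4 * sqrt 2 * ln 2)
  /\
  is_series (fun k : nat =>
      binom4 k
        * ((3575 * INR k ^ 2 - 1026 * INR k + 67) * Hcomb k
            + 242 / 13 * (175 * INR k + 12))
        / (-72) ^ k)
    (sqrt 3 * (216 / 13 - 15 * ln 3))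
  /\
  is_series (fun k : nat =>
      binom4 k
        * ((55 * INR k ^ 2 + 54 * INR k + 11) * Hcomb k + 22 * INR k + 12)
        / ((3 * INR k + 1) * (3 * INR k + 2) * (-72) ^ k))
    (3 * sqrt 3 * ln 3)
  /\
  is_series (fun k : nat =>
      binom4 k
        * ((21413 * INR k ^ 2 - 1409 * INR k + 1036) * Hcomb k
            + 4 / 23 * (118237 * INR k + 17320))
        / (-25) ^ k)
    (sqrt 5 * (1440 / 23 - 100 * ln 5))
  /\
  is_series (fun k : nat =>
      binom4 k
        * ((133 * INR k ^ 2 + 131 * INR k + 26) * Hcomb k + 76 * INR k + 40)
        / ((3 * INR k + 1) * (3 * INR k + 2) * (-25) ^ k))
    (5 * sqrt 5 * ln 5)
  /\
  is_series (fun k : nat =>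
      binom4 k
        * ((49 * INR k ^ 2 - 146 * INR k + 21) * Hcomb k - 3038 * INR k + 1160)
        / 24 ^ k)
    (sqrt 3 * (216 - 5 * ln 3))
  /\
  is_series (fun k : nat =>
      binom4 k
        * ((7 * INR k ^ 2 + 10 * INR k + 3) * Hcomb k - 2 * INR k - 4)
        / ((3 * INR k + 1) * (3 * INR k + 2) * 24 ^ k))
    (- sqrt 3 * ln 3).
Proof.
  assert (R2 : 0 < sqrt 2) by (apply sqrt_lt_R0; lra).
  assert (E2 : / sqrt 2 = sqrt 2 / 2) by (apply inv_sqrt; lra).
  assert (E3 : / sqrt 3 = sqrt 3 / 3) by (apply inv_sqrt; lra).
  assert (E5 : / sqrt 5 = sqrt 5 / 5) by (apply inv_sqrt; lra).
  split; [|split; [|split; [|split; [|split; [|split; [|split; [|split; [|split]]]]]]]].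
  (* For each d the numerical parameters solve the linear system that expresses the equality of
     the coefficients of the powers of k, with and without Hcomb k, in the two summands. *)
  - by_telescoping (-5/16) (9/16) (-216) (189/2) (-351/2) (/ 2) (-256) admissible_half.
    rewrite ln_Rinv by lra. field. lra.
  - by_scaling 4 (/ 2) (-256) admissible_half.
    rewrite ln_Rinv, E2 by lra. field.
  - by_telescoping (-5/4) 36 (-216) (-108) 6264 2 128 admissible_two. field.
  - by_scaling 1 2 128 admissible_two. ring.
  - by_telescoping (-45/4) (162/13) (-3159) 1458 (-37422/13) (/ 3) (-72) admissible_third.
    rewrite ln_Rinv, E3 by lra. field.
  - by_scaling (9/4) (/ 3) (-72) admissible_third.
    rewrite ln_Rinv, E3 by lra. field.
  - by_telescoping (-125) (1800/23) (-15525) 7425 (-342900/23) (/ 5) (-25) admissible_fifth.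
    rewrite ln_Rinv, E5 by lra. field.
  - by_scaling (25/4) (/ 5) (-25) admissible_fifth.
    rewrite ln_Rinv, E5 by lra. field.
  - by_telescoping (5/4) 54 (-81) 162 5022 3 24 admissible_three. field.
  - by_scaling (/ 4) 3 24 admissible_three. field.
Qed.
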